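(* The Algorithmic Equaliser Problem is soluble for marked morphisms of free monoids. That is, there exists an algorithm which, given finite alphabets $\Sigma,\Delta$ and two marked morphisms $g,h:\Sigma^*\to\Delta^*$, outputs (a) a finite basis for the monoid $\operatorname{Eq}(g,h)$, and also an algorithm which on the same input outputs (b) a finite automaton recognising the set $\operatorname{Eq}(g,h)\subseteq\Sigma^*$.
   Context: $\Sigma^*$ is the free monoid on $\Sigma$. A monoid morphism $f:\Sigma^*\to\Delta^*$ is marked if $f(a)$ is a non-empty word for every $a\in\Sigma$ and, for distinct $a,b\in\Sigma$, the words $f(a)$ and $f(b)$ start with different letters of $\Delta$. For morphisms $g,h:\Sigma^*\to\Delta^*$, $\operatorname{Eq}(g,h)=\{x\in\Sigma^*\mid g(x)=h(x)\}$. A morphism $f:\Sigma^*\to\Delta^*$ is given as the list of words $(f(a))_{a\in\Sigma}$. The Algorithmic Equaliser Problem consists of the two parts (a) and (b) of the claim; a part is insoluble if the required finite object does not exist. *)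

(* Defs.v *)
From mathcomp Require Import all_boot.

Set Implicit Arguments.
Unset Strict Implicit.
Unset Printing Implicit Defensive.

(** "Algorithm" means partial recursive function in the sense of Kleene:
    [recfun k] is the syntax of the k-ary ones, and [f \on v ~> y] says that
    [f] halts on the arguments [v] with value [y]. *)
Inductive recfun : nat -> Type :=
| Zero k : recfun k
| Succ : recfun 1
| Proj k (i : 'I_k) : recfun k
| Comp m k (f : recfun m) (gs : 'I_m -> recfun k) : recfun k
| Rec k (f : recfun k) (g : recfun k.+2) : recfun k.+1
| Min k (f : recfun k.+1) : recfun k.

Fixpoint rec_graph (base : nat -> Prop) (step : nat -> nat -> nat -> Prop)
    (n y : nat) : Prop :=
  if n is n'.+1 then exists2 r, rec_graph base step n' r & step n' r y
  else base y.

Fixpoint computes k (f : recfun k) : k.-tuple nat -> nat -> Prop :=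
  match f in recfun k return k.-tuple nat -> nat -> Prop with
  | Zero _ => fun _ y => y = 0
  | Succ => fun v y => y = (thead v).+1
  | Proj _ i => fun v y => y = tnth v i
  | Comp m _ f gs => fun v y =>
      exists2 w : m.-tuple nat,
        forall i, computes (gs i) v (tnth w i) & computes f w y
  | Rec _ f g => fun v y =>
      rec_graph (computes f [tuple of behead v])
        (fun n r => computes g [tuple of n :: r :: behead v]) (thead v) y
  | Min _ f => fun v y =>
      computes f [tuple of y :: v] 0 /\
      forall z, z < y -> exists t, computes f [tuple of z :: v] t.+1
  end.

Notation "f '\on' v '~>' y" := (computes f v y)
  (at level 70, v at next level, y at next level).

Lemma rec_graph_functional (base : nat -> Prop) step n y1 y2 :
    (forall a b, base a -> base b -> a = b) ->
    (forall m r a b, step m r a -> step m r b -> a = b) ->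
  rec_graph base step n y1 -> rec_graph base step n y2 -> y1 = y2.
Proof.
move=> baseU stepU; elim: n y1 y2 => [|n IHn] y1 y2 /=; first exact: baseU.
by move=> [r1 /IHn r1U s1] [r2 /r1U <-]; apply: stepU.
Qed.

Lemma computes_functional k (f : recfun k) v y1 y2 :
  f \on v ~> y1 -> f \on v ~> y2 -> y1 = y2.
Proof.
elim: f v y1 y2 => {k} [k|| k i|m k f IHf gs IHgs|k f IHf g IHg|k f IHf]
  v y1 y2 /=.
- by move=> -> ->.
- by move=> -> ->.
- by move=> -> ->.
- move=> [w1 g1 f1] [w2 g2]; suff <- : w1 = w2 by apply: IHf f1.
  by apply: eq_from_tnth => i; apply: IHgs (g1 i) (g2 i).
- by apply: rec_graph_functional => [|m r]; [apply: IHf | apply: IHg].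
move=> [f1 lt1] [f2 lt2]; case: (ltngtP y1 y2) => // lt12.
  by have [t /(IHf _ _ _ f1)] := lt2 _ lt12.
by have [t /(IHf _ _ _ f2)] := lt1 _ lt12.
Qed.

Section Words.
Variables Sigma Delta : finType.
Implicit Types (f g h : seq Sigma -> seq Delta) (x : seq Sigma).

Definition word_morphism f : Prop :=
  f [::] = [::] /\ {morph f : x y / x ++ y}.

Definition marked f : Prop :=
  (forall a, f [:: a] <> [::]) /\
  (forall a b, a <> b -> ohead (f [:: a]) <> ohead (f [:: b])).

Definition equaliser g h : {pred seq Sigma} := [pred x | g x == h x].

(** [B] lists, without repetition, a set of words freely generating [M]. *)
Definition is_basis (M : {pred seq Sigma}) (B : seq (seq Sigma)) : Prop :=
  [/\ uniq B,
      forall s : seq (seq Sigma), {subset s <= B} -> flatten s \in M,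
      forall x, x \in M -> exists2 s, {subset s <= B} & x = flatten s
    & forall s t, {subset s <= B} -> {subset t <= B} ->
        flatten s = flatten t -> s = t].

Record automaton := Automaton {
  nstates : nat;
  start : 'I_nstates;
  accepting : {set 'I_nstates};
  transition : 'I_nstates -> Sigma -> 'I_nstates }.

Definition accepts (A : automaton) x : bool :=
  foldl (@transition A) (start A) x \in accepting A.

Definition recognises (A : automaton) (L : {pred seq Sigma}) : Prop :=
  forall x, accepts A x = (x \in L).

End Words.

(** Goedel numbering. [CodeSeq.code] is a bijection from [seq nat] to [nat];
    letters of a finite alphabet are numbered by [enum_rank], in the order of
    [enum]. *)
Definition code_word (T : finType) (w : seq T) : nat :=
  CodeSeq.code [seq val (enum_rank a) | a <- w].

Definition code_words (T : finType) (ws : seq (seq T)) : nat :=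
  CodeSeq.code [seq code_word w | w <- ws].

Definition code_morphism (Sigma Delta : finType)
    (f : seq Sigma -> seq Delta) : nat :=
  code_words [seq f [:: a] | a <- enum Sigma].

Definition code_instance (Sigma Delta : finType)
    (g h : seq Sigma -> seq Delta) : nat :=
  CodeSeq.code [:: #|Sigma|; #|Delta|; code_morphism g; code_morphism h].

Definition code_automaton (Sigma : finType) (A : automaton Sigma) : nat :=
  CodeSeq.code [:: nstates A; val (start A);
    CodeSeq.code [seq val q | q <- enum (accepting A)];
    CodeSeq.code [seq CodeSeq.code [seq val (transition q a) | a <- enum Sigma]
                 | q <- enum 'I_(nstates A)]].

(* Main.v *)
Require Import Defs.
From mathcomp Require Import all_boot.
From mathcomp Require Import zify.

(** The equaliser [M] of two morphisms contains the empty word, and when [x] is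
    in [M] the word [x ++ y] is in [M] if and only if [y] is. Hence [M] is free
    on its irreducible words, the nonempty ones with no shorter nonempty prefix
    in [M] ([irreducible_basis]). If the codes of the irreducible words are less
    than a known number [N], then a basis is found by testing all words of code
    less than [N] ([basis_code_correct]). An automaton is found as well: its
    states are these words and a sink. It remembers what was read since the last
    time the prefix was in [M], and fails once the code of this remainder is too
    large for a prefix of an irreducible word ([equaliser_automaton_correct]).
    So all that is needed is a bound on the irreducible words that is computable
    from the instance.

    The bound comes from two properties of marked morphisms. First, they commute
    with longest common prefixes ([lcp_ext]), whence an irreducible solution of
    [g x = h x] is determined by its first letter ([prime_solution_uniq]).
    Second, an instance [(g, h)] can be replaced by another one. Call block a
    minimal pair [(u, v)] of nonempty words with [g u = h v]. A block is
    determined by the first letter [t] of [g u], so [g' t = u] and [h' t = v]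
    define a pair of partial morphisms, which are again marked. If [x] is a
    solution then the pair [(x, x)] is a product of blocks, so that
    [x = g' x' = h' x'] for a solution [x'] of the new instance, not longer than
    [x] ([derived_instance]). Moreover [g'] has at most as many nonempty proper
    suffixes of images of letters as [h], and likewise for [h'] and [g]: if [q]
    is such a suffix of [u], then [g q] begins within a letter image [h c], and
    the part of [h c] that is left determines [q] ([fragments_blocks]). Hence
    the lengths of all images stay bounded along the sequence of derived
    instances, and there are finitely many of those.

    When the same instance occurs twice in the sequence, with the same first
    letter of the solution, the two solutions are equal. As lengths cannot
    increase they are constant in between, which forces the letters of the
    solution to have images of length one, and the solution to be a single
    letter. So the solution has length one after a bounded number of steps, and
    each step divides its length by at most a bounded factor
    ([prime_solution_size]).

    The two algorithms are written in terms of codes and proved computable by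
    closure properties of the class of recursive functions
    ([computable_basis_code], [computable_automaton_code]). *)

Set Implicit Arguments.
Unset Strict Implicit.
Unset Printing Implicit Defensive.

Notation code := CodeSeq.code.
Notation decode := CodeSeq.decode.

(** * Computable functions of a tuple of numbers *)

(** The [k] arguments are presented as a list, so that the function defining
    the body of a recursion, which has two more arguments, can be written in
    the same way as the function that contains the recursion. In the lemmas
    below the [j]-th argument appears as [head 0 (behead (... (behead s)))],
    a form that is stable by conversion when an argument is pushed on [s]. *)
Definition computable k (F : seq nat -> nat) :=
  exists r : recfun k, forall v : k.-tuple nat, r \on v ~> F v.

Lemma computable_ext k F G : (forall s, size s = k -> F s = G s) ->
  computable k F -> computable k G.
Proof. by move=> e [r rP]; exists r => v; rewrite -e ?size_tuple. Qed.

Lemma computable_comp m k F (Gs : 'I_m -> seq nat -> nat) : computable m F ->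
  (forall i, computable k (Gs i)) ->
  computable k (fun s => F [seq Gs i s | i <- enum 'I_m]).
Proof.
move=> [f fP] /fin_all_exists[gs gsP]; exists (Comp f gs) => v /=.
exists [tuple Gs i v | i < m] => [i|]; last exact: fP.
by rewrite tnth_mktuple; apply: gsP.
Qed.

Lemma head_iter_behead j (s : seq nat) : head 0 (iter j behead s) = nth 0 s j.
Proof. by elim: j s => [|j IHj] s; rewrite ?nth0 // iterSr IHj nth_behead. Qed.

Lemma computable_nth_arg k i : i < k -> computable k (fun s => nth 0 s i).
Proof.
by move=> lt; exists (Proj (Ordinal lt)) => v /=; rewrite (tnth_nth 0).
Qed.

Lemma computable_var j k : j < k ->
  computable k (fun s => head 0 (iter j behead s)).
Proof.
move=> /computable_nth_arg; apply: computable_ext => s _.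
by rewrite head_iter_behead.
Qed.

(** Composition with an arbitrary rearrangement [E] of the arguments; all the
    composition lemmas below are instances of this one. *)
Lemma computable_subst m k F E : computable m F ->
  (forall s, size s = k -> size (E s) = m) ->
  (forall i, i < m -> computable k (fun s => nth 0 (E s) i)) ->
  computable k (fun s => F (E s)).
Proof.
move=> cF sE cE.
apply: computable_ext (computable_comp cF (fun i : 'I_m => cE i (ltn_ord i))).
move=> s /sE sEs; congr F.
apply: (@eq_from_nth _ 0); rewrite size_map size_enum_ord // => i lt.
by rewrite (nth_map (Ordinal lt)) ?size_enum_ord // nth_enum_ord.
Qed.

Lemma computable_let k F G : computable k.+1 F -> computable k G ->
  computable k (fun s => F (G s :: s)).
Proof.
move=> cF cG; apply: computable_subst cF _ _ => [s /= -> //|[|i] lt] //=.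
exact: computable_nth_arg.
Qed.

Lemma computable_nth_behead k i : i < k ->
  computable k.+1 (fun s => nth 0 (behead s) i).
Proof.
move=> lt; apply: (computable_ext (fun s _ => esym (nth_behead 0 s i))).
exact: computable_nth_arg.
Qed.

Lemma computable_weaken k F : computable k F ->
  computable k.+1 (fun s => F (behead s)).
Proof.
move=> cF; apply: computable_subst cF _ _ => [s ss|i lt].
  by rewrite size_behead ss.
exact: computable_nth_behead.
Qed.

Lemma computable_op1 (f : nat -> nat) k F :
  computable 1 (fun s => f (head 0 s)) ->
  computable k F -> computable k (fun s => f (F s)).
Proof.
move=> cf cF.
by apply: (computable_subst cf (E := fun s => [:: F s])) => // -[].
Qed.

Lemma computable_op2 (f : nat -> nat -> nat) k F G :
  computable 2 (fun s => f (head 0 s) (head 0 (behead s))) ->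
  computable k F -> computable k G -> computable k (fun s => f (F s) (G s)).
Proof.
move=> cf cF cG.
by apply: (computable_subst cf (E := fun s => [:: F s; G s])) => // -[|[]].
Qed.

Lemma computable_op3 (f : nat -> nat -> nat -> nat) k F G H :
  computable 3 (fun s =>
    f (head 0 s) (head 0 (behead s)) (head 0 (behead (behead s)))) ->
  computable k F -> computable k G -> computable k H ->
  computable k (fun s => f (F s) (G s) (H s)).
Proof.
move=> cf cF cG cH.
apply: (computable_subst cf (E := fun s => [:: F s; G s; H s])) => //.
by case=> [|[|[]]].
Qed.

Lemma computable_const k n : computable k (fun=> n).
Proof.
elim: n => [|n [f fP]]; first by exists (Zero k).
exists (Comp Succ (fun=> f)) => v /=.
by exists [tuple n] => // i; rewrite ord1; apply: fP.
Qed.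

Lemma computable_succ k F : computable k F -> computable k (fun s => (F s).+1).
Proof.
apply: computable_op1; exists Succ => v /=.
by case/tupleP: v => x v; rewrite theadE.
Qed.

Lemma computable_iteri k N B (S : nat -> nat -> seq nat -> nat) :
  computable k N -> computable k B ->
  computable k.+2 (fun s =>
    S (head 0 s) (head 0 (behead s)) (behead (behead s))) ->
  computable k (fun s => iteri (N s) (fun i r => S i r s) (B s)).
Proof.
move=> cN [b bP] [g gP].
pose R s := iteri (head 0 s) (fun i r => S i r (behead s)) (B (behead s)).
suff cR : computable k.+1 R by exact: computable_let cR cN.
exists (Rec b g) => v; rewrite /R /=.
have -> : head 0 v = thead v by case/tupleP: v => a v; rewrite theadE.
elim: (thead v) => [|n IHn] /=; first exact: (bP [tuple of behead v]).
by exists (iteri n (fun i r => S i r (behead v)) (B (behead v))).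
Qed.

(** A function is computable as soon as its value is characterised as the
    least solution of a computable condition. *)
Lemma computable_min k F (P : nat -> seq nat -> bool) :
  computable k.+1 (fun s => ~~ P (head 0 s) (behead s)) ->
  (forall s, P (F s) s /\ forall y, P y s -> F s <= y) -> computable k F.
Proof.
move=> [p pP] FP; exists (Min p) => v /=; have [PF minF] := FP v; split.
  by have := pP [tuple of F v :: v]; rewrite /= PF.
move=> z lt; exists 0; have := pP [tuple of z :: v].
suff -> : P z v = false by [].
by apply/negbTE/negP => /minF; rewrite leqNgt lt.
Qed.

(** The goals [computable k (fun s => e)] are solved by recursion on the
    expression [e], to which each operation contributes its own lemma.
    Unfolding is disabled so that the lemma is chosen by the head symbol. *)
Create HintDb computable discriminated.
#[local] Hint Constants Opaque : computable.

#[local] Hint Extern 1 (computable _ (head 0)) =>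
  exact: (@computable_var 0) : computable.
#[local] Hint Extern 1 (computable _ (fun s => head 0 s)) =>
  exact: (@computable_var 0) : computable.
#[local] Hint Extern 1 (computable _ (fun s => head 0 (behead s))) =>
  exact: (@computable_var 1) : computable.
#[local] Hint Extern 1
    (computable _ (fun s => head 0 (behead (behead s)))) =>
  exact: (@computable_var 2) : computable.
#[local] Hint Extern 1
    (computable _ (fun s => head 0 (behead (behead (behead s))))) =>
  exact: (@computable_var 3) : computable.
#[local] Hint Extern 1
    (computable _ (fun s => head 0 (behead (behead (behead (behead s)))))) =>
  exact: (@computable_var 4) : computable.
#[local] Hint Extern 1 (computable _ (fun _ => ?n)) =>
  exact: computable_const : computable.
#[local] Hint Resolve computable_succ : computable.
#[local] Hint Resolve computable_iteri : computable.

Ltac computable := solve [typeclasses eauto with computable].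

Lemma computable_add k F G : computable k F -> computable k G ->
  computable k (fun s => F s + G s).
Proof.
apply: computable_op2; apply: (@computable_ext _ (fun s =>
  iteri (head 0 s) (fun _ r => r.+1) (head 0 (behead s)))).
  by move=> s _; elim: (head 0 s) => //= n ->.
computable.
Qed.
#[local] Hint Resolve computable_add : computable.

Lemma computable_pred k F : computable k F -> computable k (fun s => (F s).-1).
Proof.
apply: computable_op1.
apply: (@computable_ext _ (fun s => iteri (head 0 s) (fun i _ => i) 0)).
  by move=> s _; case: (head 0 s).
computable.
Qed.
#[local] Hint Resolve computable_pred : computable.

Lemma computable_sub k F G : computable k F -> computable k G ->
  computable k (fun s => F s - G s).
Proof.
apply: computable_op2; apply: (@computable_ext _ (fun s =>
  iteri (head 0 (behead s)) (fun _ r => r.-1) (head 0 s))).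
  by move=> s _; elim: (head 0 (behead s)) => [|n /= ->]; rewrite ?subn0 ?subnS.
computable.
Qed.
#[local] Hint Resolve computable_sub : computable.

Lemma computable_mul k F G : computable k F -> computable k G ->
  computable k (fun s => F s * G s).
Proof.
apply: computable_op2; apply: (@computable_ext _ (fun s =>
  iteri (head 0 s) (fun _ r => head 0 (behead s) + r) 0)).
  by move=> s _; elim: (head 0 s) => //= n ->; rewrite mulSn.
computable.
Qed.
#[local] Hint Resolve computable_mul : computable.

Lemma computable_exp k F G : computable k F -> computable k G ->
  computable k (fun s => F s ^ G s).
Proof.
apply: computable_op2; apply: (@computable_ext _ (fun s =>
  iteri (head 0 (behead s)) (fun _ r => head 0 s * r) 1)).
  by move=> s _; elim: (head 0 (behead s)) => //= n ->; rewrite expnS.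
computable.
Qed.
#[local] Hint Resolve computable_exp : computable.

Lemma computable_if k (P : seq nat -> bool) F G :
  computable k P -> computable k F -> computable k G ->
  computable k (fun s => if P s then F s else G s).
Proof.
move=> cP cF cG.
apply: (@computable_ext _ (fun s =>
  iteri (P s) (fun _ _ => F s) (G s))) => [s _|].
  by case: (P s).
apply: (@computable_op3 (fun b x y => iteri b (fun _ _ => x) y)) => //.
computable.
Qed.
#[local] Hint Resolve computable_if : computable.

Lemma computable_not k (P : seq nat -> bool) : computable k P ->
  computable k (fun s => ~~ P s).
Proof.
move=> cP; apply: (@computable_ext _ (fun s => 1 - P s)) => [s _|].
  by case: (P s).
computable.
Qed.
#[local] Hint Resolve computable_not : computable.

Lemma computable_and k (P Q : seq nat -> bool) :
  computable k P -> computable k Q ->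
  computable k (fun s => P s && Q s).
Proof.
move=> cP cQ; apply: (@computable_ext _ (fun s => P s * Q s)) => [s _|].
  by rewrite mulnb.
computable.
Qed.
#[local] Hint Resolve computable_and : computable.

Lemma computable_or k (P Q : seq nat -> bool) :
  computable k P -> computable k Q ->
  computable k (fun s => P s || Q s).
Proof.
move=> cP cQ; apply: (@computable_ext _ (fun s => ~~ (~~ P s && ~~ Q s))).
  by move=> s _; case: (P s); case: (Q s).
computable.
Qed.
#[local] Hint Resolve computable_or : computable.

Lemma computable_leq k F G : computable k F -> computable k G ->
  computable k (fun s => F s <= G s).
Proof.
move=> cF cG; apply: (@computable_ext _ (fun s => 1 - (F s - G s))) => [s _|].
  by case: leqP => le /=; lia.
computable.
Qed.
#[local] Hint Resolve computable_leq : computable.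

Lemma computable_eqn k F G : computable k F -> computable k G ->
  computable k (fun s => F s == G s).
Proof.
move=> cF cG.
apply: (@computable_ext _ (fun s => (F s <= G s) && (G s <= F s))) => [s _|].
  by rewrite eqn_leq.
computable.
Qed.
#[local] Hint Resolve computable_eqn : computable.

Lemma computable_has k N (P : nat -> seq nat -> bool) : computable k N ->
  computable k.+2 (fun s => P (head 0 s) (behead (behead s))) ->
  computable k (fun s => has (fun i => P i s) (iota 0 (N s))).
Proof.
move=> cN cP; apply: (@computable_ext _ (fun s =>
  iteri (N s) (fun i r => P i s || (0 < r)) 0)) => [s _|].
  elim: (N s) => // n IHn; rewrite -[in RHS]addn1 iotaD has_cat add0n /= IHn.
  by rewrite orbF orbC; case: (has _ _) (P n s) => -[].
computable.
Qed.
#[local] Hint Resolve computable_has : computable.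

(** * Computable functions on coded lists *)

Lemma codeE x l : code (x :: l) = 2 ^ x * (code l + code l).+1.
Proof. by rewrite addnn. Qed.

Lemma code_head_lt x l : x < code (x :: l).
Proof. by have /andP[] := CodeSeq.ltn_code (x :: l). Qed.

Lemma code_behead_lt x l : code l < code (x :: l).
Proof. by rewrite codeE; have := expn_gt0 2 x; nia. Qed.

Lemma size_le_code l : size l <= code l.
Proof. by elim: l => //= x l IHl; apply: leq_trans (code_behead_lt x l). Qed.

Lemma cons_code_inj x m y l :
  2 ^ x * (m + m).+1 = code (y :: l) -> x = y /\ m = code l.
Proof.
rewrite -[m]CodeSeq.decodeK -codeE => /(can_inj CodeSeq.codeK)[-> ->].
by [].
Qed.

Lemma computable_list1 (f : seq nat -> nat) k X :
  computable 1 (fun s => f (decode (head 0 s))) ->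
  computable k (fun s => code (X s)) -> computable k (fun s => f (X s)).
Proof.
move=> cf cX; apply: computable_ext (computable_op1 (f := f \o decode) cf cX).
by move=> s _ /=; rewrite CodeSeq.codeK.
Qed.

Lemma computable_list2 (f : nat -> seq nat -> nat) k F X :
  computable 2 (fun s => f (head 0 s) (decode (head 0 (behead s)))) ->
  computable k F -> computable k (fun s => code (X s)) ->
  computable k (fun s => f (F s) (X s)).
Proof.
move=> cf cF cX.
apply: computable_ext
  (computable_op2 (f := fun m n => f m (decode n)) cf cF cX).
by move=> s _ /=; rewrite CodeSeq.codeK.
Qed.

Lemma computable_cons k F X : computable k F ->
  computable k (fun s => code (X s)) ->
  computable k (fun s => code (F s :: X s)).
Proof.
move=> cF cX; apply: (@computable_ext _ (fun s =>
  2 ^ F s * (code (X s) + code (X s)).+1)) => [s _|]; first by rewrite codeE.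
computable.
Qed.
#[local] Hint Resolve computable_cons : computable.

Lemma computable_decode k F : computable k F ->
  computable k (fun s => code (decode (F s))).
Proof. by apply: computable_ext => s _; rewrite CodeSeq.decodeK. Qed.
#[local] Hint Resolve computable_decode : computable.

(** The head and the tail of a list are found by searching for the two factors
    in [2 ^ x * (m + m).+1]; the empty list has code [0]. *)
Lemma computable_head k X : computable k (fun s => code (X s)) ->
  computable k (fun s => head 0 (X s)).
Proof.
apply: computable_list1.
apply: (@computable_min _ _ (fun x s => (head 0 s == 0) ||
  has (fun m => 2 ^ x * (m + m).+1 == head 0 s) (iota 0 (head 0 s)))).
  computable.
move=> s; move: (head 0 s) => n; rewrite -[n]CodeSeq.decodeK.
case: (decode n) => [|x l]; rewrite CodeSeq.codeK; first by split.
split=> [|y /orP[/eqP e|/hasP[m _ /eqP /cons_code_inj[-> _]]]] //.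
  apply/orP; right; apply/hasP; exists (code l); last by rewrite codeE.
  by rewrite mem_iota add0n code_behead_lt.
by have := code_head_lt x l; rewrite e.
Qed.
#[local] Hint Resolve computable_head : computable.

Lemma computable_behead k X : computable k (fun s => code (X s)) ->
  computable k (fun s => code (behead (X s))).
Proof.
apply: (@computable_list1 (fun l => code (behead l))).
apply: (@computable_min _ _ (fun m s => (head 0 s == 0) ||
  has (fun x => 2 ^ x * (m + m).+1 == head 0 s) (iota 0 (head 0 s)))).
  computable.
move=> s; move: (head 0 s) => n; rewrite -[n]CodeSeq.decodeK.
case: (decode n) => [|x l]; rewrite CodeSeq.codeK; first by split.
split=> [|y /orP[/eqP e|/hasP[m _ /eqP /cons_code_inj[_ ->]]]] //.
  apply/orP; right; apply/hasP; exists x; last by rewrite codeE.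
  by rewrite mem_iota add0n code_head_lt.
by have := code_head_lt x l; rewrite e.
Qed.
#[local] Hint Resolve computable_behead : computable.

Lemma computable_drop k F X :
  computable k F -> computable k (fun s => code (X s)) ->
  computable k (fun s => code (drop (F s) (X s))).
Proof.
apply: (@computable_list2 (fun m l => code (drop m l))).
apply: (@computable_ext _ (fun s => iteri (head 0 s)
  (fun _ r => code (behead (decode r))) (head 0 (behead s)))) => [s _|].
  elim: (head 0 s) => [|n /= ->]; first by rewrite drop0 CodeSeq.decodeK.
  by rewrite CodeSeq.codeK -drop1 drop_drop add1n.
computable.
Qed.
#[local] Hint Resolve computable_drop : computable.

Lemma computable_nth k F X :
  computable k F -> computable k (fun s => code (X s)) ->
  computable k (fun s => nth 0 (X s) (F s)).
Proof.
move=> cF cX; apply: (@computable_ext _ (fun s => head 0 (drop (F s) (X s)))).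
  by move=> s _; rewrite -nth0 nth_drop addn0.
computable.
Qed.
#[local] Hint Resolve computable_nth : computable.

(** A right fold as an iteration over the suffixes of [X], from the shortest to
    the longest. The number [n] of steps may exceed the length of [X], as the
    suffixes met in excess are empty; it will be [code X]. *)
Lemma iteri_foldr (T : Type) (S : nat -> T -> T) B X n : size X <= n ->
  foldr S B X = iteri n (fun i r =>
    if code (drop (n - i.+1) X) == 0 then r
    else S (head 0 (drop (n - i.+1) X)) r) B.
Proof.
move=> le; set step := fun i r => _.
suff H j : j <= n -> foldr S B (drop (n - j) X) = iteri j step B.
  by have := H n (leqnn n); rewrite {1}subnn drop0.
elim: j => [|j IHj] lt; first by rewrite subn0 drop_oversize.
rewrite /= -IHj ?(ltnW lt) // /step.
have -> : drop (n - j) X = behead (drop (n - j.+1) X).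
  by rewrite -drop1 drop_drop; congr drop; lia.
case: (drop _ X) => [|x l] //.
by rewrite -[code _ == 0]negbK -lt0n (leq_ltn_trans _ (code_head_lt x l)).
Qed.

Lemma computable_foldr k X B (S : nat -> nat -> seq nat -> nat) :
  computable k (fun s => code (X s)) -> computable k B ->
  computable k.+2 (fun s =>
    S (head 0 s) (head 0 (behead s)) (behead (behead s))) ->
  computable k (fun s => foldr (fun x r => S x r s) (B s) (X s)).
Proof.
move=> cX cB cS; apply: (computable_ext (fun s _ =>
  esym (iteri_foldr (fun x r => S x r s) (B s) (size_le_code (X s))))).
have cX2 := computable_weaken (computable_weaken cX).
pose Y s := drop (code (X (behead (behead s))) - (head 0 s).+1)
                 (X (behead (behead s))).
have cY : computable k.+2 (fun s => head 0 (Y s)) by rewrite /Y; computable.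
have cSY : computable k.+2 (fun s =>
    S (head 0 (Y s)) (head 0 (behead s)) (behead (behead s))).
  apply: (computable_subst cS (E := fun s => head 0 (Y s) :: behead s)).
    by case=> //= x s [->].
  by case=> [|i] lt //=; apply: computable_nth_behead.
computable.
Qed.
#[local] Hint Resolve computable_foldr : computable.

Lemma computable_foldr_code k X B (S : nat -> seq nat -> seq nat -> seq nat) :
  computable k (fun s => code (X s)) -> computable k (fun s => code (B s)) ->
  computable k.+2 (fun s =>
    code (S (head 0 s) (decode (head 0 (behead s))) (behead (behead s)))) ->
  computable k (fun s => code (foldr (fun x r => S x r s) (B s) (X s))).
Proof.
move=> cX cB cS; apply: (@computable_ext _ (fun s =>
  foldr (fun x r => code (S x (decode r) s)) (code (B s)) (X s))) => [s _|].
  by elim: (X s) => //= x l ->; rewrite CodeSeq.codeK.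
exact: computable_foldr.
Qed.
#[local] Hint Resolve computable_foldr_code : computable.

Lemma computable_all k X (P : nat -> seq nat -> bool) :
  computable k (fun s => code (X s)) ->
  computable k.+2 (fun s => P (head 0 s) (behead (behead s))) ->
  computable k (fun s => all (fun i => P i s) (X s)).
Proof.
move=> cX cP; apply: (@computable_ext _ (fun s =>
  foldr (fun x r => P x s && (0 < r)) 1 (X s))) => [s _|]; last by computable.
by elim: (X s) => //= x l ->; case: (all _ l).
Qed.
#[local] Hint Resolve computable_all : computable.

Lemma computable_size k X : computable k (fun s => code (X s)) ->
  computable k (fun s => size (X s)).
Proof.
move=> cX.
apply: (@computable_ext _ (fun s => foldr (fun _ r => r.+1) 0 (X s))).
  by move=> s _; elim: (X s) => //= x l ->.
computable.
Qed.
#[local] Hint Resolve computable_size : computable.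

Lemma computable_cat k X Y :
  computable k (fun s => code (X s)) -> computable k (fun s => code (Y s)) ->
  computable k (fun s => code (X s ++ Y s)).
Proof.
move=> cX cY; apply: (@computable_ext _ (fun s =>
  code (foldr (fun x r => x :: r) (Y s) (X s)))); last by computable.
by move=> s _; congr code; elim: (X s) => //= x l ->.
Qed.
#[local] Hint Resolve computable_cat : computable.

Lemma computable_map k X (F : nat -> seq nat -> nat) :
  computable k (fun s => code (X s)) ->
  computable k.+2 (fun s => F (head 0 s) (behead (behead s))) ->
  computable k (fun s => code [seq F x s | x <- X s]).
Proof.
move=> cX cF; apply: (@computable_ext _ (fun s =>
  code (foldr (fun x r => F x s :: r) [::] (X s)))); last by computable.
by move=> s _; congr code; elim: (X s) => //= x l ->.
Qed.
#[local] Hint Resolve computable_map : computable.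

Lemma computable_filter k X (P : nat -> seq nat -> bool) :
  computable k (fun s => code (X s)) ->
  computable k.+2 (fun s => P (head 0 s) (behead (behead s))) ->
  computable k (fun s => code [seq x <- X s | P x s]).
Proof.
move=> cX cP; apply: (@computable_ext _ (fun s =>
  foldr (fun x r => if P x s then code (x :: decode r) else r) 0 (X s))).
  move=> s _; elim: (X s) => //= x l ->.
  by case: (P x s); rewrite ?CodeSeq.codeK.
computable.
Qed.
#[local] Hint Resolve computable_filter : computable.

Lemma computable_iota k N : computable k N ->
  computable k (fun s => code (iota 0 (N s))).
Proof.
apply: (@computable_op1 (fun n => code (iota 0 n))).
apply: (@computable_ext _ (fun s => iteri (head 0 s) (fun i r =>
  code (head 0 s - i.+1 :: decode r)) 0)); last by computable.
move=> s _; move: (head 0 s) => n.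
suff H j : j <= n ->
    iteri j (fun i r => code (n - i.+1 :: decode r)) 0 = code (iota (n - j) j).
  by rewrite H // subnn.
elim: j => // j IHj lt; rewrite iteriS IHj ?(ltnW lt) // CodeSeq.codeK.
by rewrite [in RHS]/iota -/iota -subSn // subSS.
Qed.
#[local] Hint Resolve computable_iota : computable.

Lemma computable_rcons k X F : computable k (fun s => code (X s)) ->
  computable k F -> computable k (fun s => code (rcons (X s) (F s))).
Proof.
move=> cX cF; apply: (@computable_ext _ (fun s => code (X s ++ [:: F s]))).
  by move=> s _; rewrite cats1.
computable.
Qed.
#[local] Hint Resolve computable_rcons : computable.

Lemma computable_eqseq k X Y : computable k (fun s => code (X s)) ->
  computable k (fun s => code (Y s)) -> computable k (fun s => X s == Y s).
Proof.
move=> cX cY; apply: (@computable_ext _ (fun s => code (X s) == code (Y s))).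
  by move=> s _; rewrite (can_eq CodeSeq.codeK).
computable.
Qed.
#[local] Hint Resolve computable_eqseq : computable.

(** The expression [i - (i - size l)] is [minn i (size l)] in terms of
    operations known to be computable. *)
Lemma take_mkseq (l : seq nat) i :
  take i l = [seq nth 0 l j | j <- iota 0 (i - (i - size l))].
Proof.
have e : i - (i - size l) = minn i (size l) by lia.
rewrite e; apply: (@eq_from_nth _ 0); rewrite size_take_min.
  by rewrite size_map size_iota.
move=> j lt; rewrite (nth_map 0) ?size_iota // nth_iota // add0n nth_take //.
by move: lt; rewrite leq_min => /andP[].
Qed.

Lemma computable_take k F X :
  computable k F -> computable k (fun s => code (X s)) ->
  computable k (fun s => code (take (F s) (X s))).
Proof.
apply: (@computable_list2 (fun m l => code (take m l))).
apply: (computable_ext (fun s _ => congr1 code (esym (take_mkseq _ _)))).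
computable.
Qed.
#[local] Hint Resolve computable_take : computable.

(** * Counting and bounds *)

Lemma size_functional (A B : eqType) (R : A -> B -> Prop) (X : seq A)
    (Y : seq B) :
  uniq Y -> (forall y, y \in Y -> exists2 x, x \in X & R x y) ->
  (forall x y y', R x y -> R x y' -> y = y') -> size Y <= size X.
Proof.
move=> uY ex fR.
have [f fP] : exists f : 'I_(size Y) -> A, forall i : 'I_(size Y),
    f i \in X /\ (forall y0, R (f i) (nth y0 Y i)).
  apply: (fin_all_exists (P := fun (i : 'I_(size Y)) x =>
    x \in X /\ forall y0, R x (nth y0 Y i))) => i.
  case: Y {uY} ex i => [|y0 Y] ex i; first by case: i.
  have [x xX Rx] := ex (nth y0 (y0 :: Y) i) (mem_nth y0 (ltn_ord i)).
  by exists x; split=> // y1; rewrite (set_nth_default y0).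
rewrite -[X in X <= _](size_enum_ord) -(size_map f).
apply: uniq_leq_size => [|x /mapP[i _ ->]]; last by have [] := fP i.
rewrite map_inj_uniq ?enum_uniq // => i j eij; apply: val_inj => /=.
have /hasP[y0 _ _] : has predT Y.
  by rewrite has_predT; apply: leq_ltn_trans (ltn_ord i).
apply/eqP; rewrite -(nth_uniq y0 (ltn_ord i) (ltn_ord j) uY); apply/eqP.
have [_ /(_ y0) Ri] := fP i; have [_ /(_ y0)] := fP j.
by rewrite -eij => Rj; apply: fR Ri Rj.
Qed.

(** The exponent is the number of states of the pigeonhole argument below, for
    an alphabet of [n] letters and images of length at most [s.+1]. *)
Definition length_bound n s := s.+1 ^ (n.+1 ^ (n * 2 * s.+1) * n.+1).

Lemma length_bound_mono n n' s s' : n <= n' -> s <= s' ->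
  length_bound n s <= length_bound n' s'.
Proof.
move=> ln ls; rewrite /length_bound.
have le : n.+1 ^ (n * 2 * s.+1) * n.+1 <= n'.+1 ^ (n' * 2 * s'.+1) * n'.+1.
  rewrite leq_mul // (leq_trans (_ : _ <= n'.+1 ^ (n * 2 * s.+1))) //.
    by case: (n * 2 * s.+1) => // k; rewrite leq_exp2r.
  by rewrite leq_pexp2l // !leq_mul.
apply: leq_trans (leq_pexp2l _ le) _ => //.
by rewrite leq_exp2r // muln_gt0 expn_gt0.
Qed.

(** * Partial marked maps and longest common prefixes *)

Section PartialMarked.
Variable T : finType.
Implicit Types (a : T) (f g h : T -> seq T) (u v x y z : seq T).

(** Only letters with a nonempty image are considered to be in the domain of
    [f]: a word is supported if all its letters are, and [pmarked] is the
    property of being marked on the domain. Domain and codomain have the same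
    alphabet because deriving an instance exchanges the two alphabets, while
    the instances of the whole sequence have to be compared with each other. *)
Definition ext f x := flatten [seq f a | a <- x].
Definition supported f x := all (fun a => f a != [::]) x.
Definition pmarked f :=
  forall a b, f a != [::] -> ohead (f a) = ohead (f b) -> a = b.

Lemma ext_cat f x y : ext f (x ++ y) = ext f x ++ ext f y.
Proof. by rewrite /ext map_cat flatten_cat. Qed.

Lemma ext_take_drop f i x : ext f x = ext f (take i x) ++ ext f (drop i x).
Proof. by rewrite -ext_cat cat_take_drop. Qed.

Lemma supported_take f i x : supported f x -> supported f (take i x).
Proof. by rewrite /supported -{1}(cat_take_drop i x) all_cat => /andP[]. Qed.

Lemma supported_drop f i x : supported f x -> supported f (drop i x).
Proof. by rewrite /supported -{1}(cat_take_drop i x) all_cat => /andP[]. Qed.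

Lemma size_ext_ge f x : supported f x -> size x <= size (ext f x).
Proof.
elim: x => //= a x IHx /andP[fa /IHx]; rewrite /ext /= -/(ext f x) size_cat.
by case: (f a) fa => //= b w _; lia.
Qed.

Lemma ext_eq_nil f x : supported f x -> ext f x = [::] -> x = [::].
Proof. by move=> /size_ext_ge le /(congr1 size) /= e; apply: size0nil; lia. Qed.

Lemma ext_take_eq f i x :
  supported f x -> ext f (take i x) = ext f x -> size x <= i.
Proof.
move=> sx; rewrite (ext_take_drop f i x) -[LHS]cats0.
move=> /(congr1 (drop (size (ext f (take i x))))); rewrite !drop_size_cat //.
move=> /esym/(ext_eq_nil (supported_drop _ sx)) /(congr1 size).
by rewrite size_drop /=; lia.
Qed.

Fixpoint lcp x y :=
  match x, y with
  | a :: x', b :: y' => if a == b then a :: lcp x' y' else [::]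
  | _, _ => [::]
  end.

Lemma lcpC x y : lcp x y = lcp y x.
Proof.
elim: x y => [|a x IHx] [|b y] //=; rewrite (eq_sym b).
by case: eqP => [->|//]; rewrite IHx.
Qed.

Lemma lcp_idem x : lcp x x = x.
Proof. by elim: x => //= a x ->; rewrite eqxx. Qed.

Lemma lcp_take x y : lcp x y = take (size (lcp x y)) x.
Proof.
elim: x y => [|a x IHx] [|b y] //=.
by case: eqP => //= _; rewrite -IHx.
Qed.

Lemma lcp_cat z x y : lcp (z ++ x) (z ++ y) = z ++ lcp x y.
Proof. by elim: z => //= a z ->; rewrite eqxx. Qed.

Lemma lcp_ohead x y : ohead x = ohead y -> x != [::] -> 0 < size (lcp x y).
Proof. by case: x y => [|a x] [|b y] //= [->] _; rewrite eqxx. Qed.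

(** After the common prefix, the next two letters are distinct and their images
    differ from the first letter on. *)
Lemma lcp_ext f x y : pmarked f -> supported f x -> supported f y ->
  lcp (ext f x) (ext f y) = ext f (lcp x y).
Proof.
move=> mf; elim: x y => [|a x IHx] [|b y] //=.
  by move=> _ _; rewrite lcpC.
move=> /andP[fa sx] /andP[fb sy]; rewrite /ext /= -!/(ext f _).
case: eqP => [<-|neq]; first by rewrite lcp_cat IHx.
have := mf a b fa; case: (f a) (f b) fa fb => [|a' u] [|b' v] //= _ _ ab.
by case: eqP => // e; case: neq; apply: ab; rewrite e.
Qed.

Lemma ext_inj f x y : pmarked f -> supported f x -> supported f y ->
  ext f x = ext f y -> x = y.
Proof.
move=> mf sx sy e; have := lcp_ext mf sx sy; rewrite -{1}e lcp_idem => e1.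
have e2 : lcp x y = x.
  rewrite lcp_take take_oversize //; apply: (ext_take_eq sx).
  by rewrite -lcp_take.
rewrite -e2 lcpC lcp_take take_oversize //; apply: (ext_take_eq sy).
by rewrite -lcp_take lcpC -e1.
Qed.

(** * Prime solutions and blocks *)

Definition prime_solution g h x :=
  [/\ x != [::], supported g x, supported h x, ext g x = ext h x &
      forall i, 0 < i -> ext g (take i x) = ext h (take i x) -> size x <= i].

(** The longest common prefix of two solutions is a solution by [lcp_ext]. *)
Lemma prime_solution_uniq g h x y : pmarked g -> pmarked h ->
  prime_solution g h x -> prime_solution g h y -> ohead x = ohead y -> x = y.
Proof.
move=> mg mh [nx gx hx ex px] [_ gy hy ey py] hd.
have pos := lcp_ohead hd nx.
have e : ext g (lcp x y) = ext h (lcp x y) by rewrite -!lcp_ext // ex ey.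
have ->: x = lcp x y.
  by rewrite lcp_take take_oversize //; apply: px; rewrite -?lcp_take.
rewrite lcpC lcp_take take_oversize //; rewrite lcpC; apply: py => //.
by rewrite [lcp x y]lcpC -lcp_take lcpC.
Qed.

(** Here [z] is an overhang: a part of the [h]-side that precedes [h v] and
    that [g] still has to match. The words [u] and [v] are then chosen so that
    the two sides end at the same place for the first time. *)
Definition first_meet g h z u v :=
  [/\ supported g u, supported h v, ext g u = z ++ ext h v &
      forall i j, 0 < i -> ext g (take i u) = z ++ ext h (take j v) ->
        size u <= i].

(** As for solutions, the longest common prefixes of [u], [u'] and of [v], [v']
    meet; the condition on [ohead] makes the former nonempty. *)
Lemma first_meet_uniq g h z u v u' v' : pmarked g -> pmarked h ->
  first_meet g h z u v -> first_meet g h z u' v' ->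
  ohead (ext g u) = ohead (ext g u') -> u != [::] -> u = u' /\ v = v'.
Proof.
move=> mg mh [gu hv e p] [gu' hv' e' p'] hd nu.
have ne : ext g u != [::] by apply: contraNneq nu => /(ext_eq_nil gu) ->.
have := lcp_ohead hd ne; rewrite lcp_ext // => pos.
have {}pos : 0 < size (lcp u u') by case: (lcp u u') pos.
have el : ext g (lcp u u') = z ++ ext h (lcp v v').
  by rewrite -!lcp_ext // e e' lcp_cat.
have eu : u = lcp u u'.
  rewrite lcp_take take_oversize //; apply: (p _ (size (lcp v v'))) => //.
  by rewrite -!lcp_take.
have eu' : u' = lcp u u'.
  rewrite lcpC lcp_take take_oversize // lcpC.
  apply: (p' _ (size (lcp v' v))) => //.
  by rewrite [lcp u u']lcpC -!lcp_take lcpC el lcpC.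
have uu : u = u' by rewrite eu' -eu.
split=> //; apply: (ext_inj mh) => //.
move: e; rewrite uu e' => /(congr1 (drop (size z))).
by rewrite !drop_size_cat.
Qed.

Definition block g h u v := u != [::] /\ first_meet g h [::] u v.

Lemma block_uniq g h u v u' v' : pmarked g -> pmarked h ->
  block g h u v -> block g h u' v' -> ohead (ext g u) = ohead (ext g u') ->
  u = u' /\ v = v'.
Proof.
by move=> mg mh [nu fu] [_ fu'] hd; apply: (first_meet_uniq mg mh fu).
Qed.

Lemma block_sym g h u v : block g h u v -> block h g v u.
Proof.
move=> [nu [gu hv e p]]; split.
  by apply: contraNneq nu => v0; apply/eqP/(ext_eq_nil gu); rewrite e v0.
split=> // j i j0 /esym /= eij.
case: (posnP i) => [i0|i0].
  move: eij; rewrite i0 take0 => /esym/(ext_eq_nil (supported_take _ hv)).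
  by move/(congr1 size); rewrite size_take_min /=; lia.
have := p i j i0 eij => le; move: eij; rewrite take_oversize // e => /esym.
exact: ext_take_eq.
Qed.

(** Cut at the shortest nonempty prefix of [u] whose image is the image of a
    prefix of [v], and repeat. *)
Lemma block_decomposition g h u v : supported g u -> supported h v ->
  ext g u = ext h v ->
  exists bs : seq (seq T * seq T), [/\ u = flatten (map fst bs),
    v = flatten (map snd bs) & forall b, b \in bs -> block g h b.1 b.2].
Proof.
have [n] := ubnP (size u); elim: n u v => // n IHn u v /ltnSE le gu hv e.
case: (eqVneq u [::]) => [u0|nu].
  exists [::]; split=> //=; apply: (ext_eq_nil hv); by rewrite -e u0.
pose P i := (0 < i) &&
  has (fun j => ext g (take i u) == ext h (take j v)) (iota 0 (size v).+1).
have exP : exists i, P i.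
  exists (size u); rewrite /P lt0n size_eq0 nu; apply/hasP.
  by exists (size v); rewrite ?mem_iota //= !take_size e.
case: (ex_minnP exP) => i /andP[i0 /hasP[j _ /eqP eij]] mini.
have lu : i <= size u.
  suff /mini : P (size u) by lia.
  rewrite /P lt0n size_eq0 nu; apply/hasP.
  by exists (size v); rewrite ?mem_iota //= !take_size e.
have [] := IHn (drop i u) (drop j v).
- by rewrite size_drop; move: nu; rewrite -size_eq0; lia.
- exact: supported_drop.
- exact: supported_drop.
- move: e; rewrite (ext_take_drop g i) (ext_take_drop h j) eij.
  by move/(congr1 (drop (size (ext h (take j v))))); rewrite !drop_size_cat.
move=> bs [eu ev bl]; exists ((take i u, take j v) :: bs); split=> /=.
- by rewrite -eu cat_take_drop.
- by rewrite -ev cat_take_drop.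
move=> b; rewrite inE => /orP[/eqP ->|/bl //] /=; split.
  by rewrite -size_eq0 size_take_min; move: nu; rewrite -size_eq0; lia.
split=> [||//|]; [exact: supported_take | exact: supported_take |].
move=> i' j' i'0 /= eij'; rewrite size_take_min.
have [le2|/ltnW lt2] := leqP i i'; first by lia.
rewrite -(minn_idPl lt2); suff /mini : P i' by lia.
rewrite /P i'0; apply/hasP; exists (minn (minn j' j) (size v)).
  by rewrite mem_iota; lia.
apply/eqP; move: eij'; rewrite -!take_min (minn_idPl lt2) => ->.
by rewrite [in RHS]take_min take_size.
Qed.

(** * Derived instances *)

(** The nonempty proper suffixes of the images of letters. *)
Definition fragments f : seq (seq T) :=
  undup [seq drop i (f a) | a <- enum T, i <- iota 1 (size (f a)).-1].

Lemma fragmentsP f q :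
  reflect (exists a i, 0 < i < size (f a) /\ q = drop i (f a))
          (q \in fragments f).
Proof.
rewrite mem_undup; apply: (iffP allpairsPdep) => [[a [i [_]]]|[a [i [lt ->]]]].
  by rewrite mem_iota => lt ->; exists a, i; split=> //; lia.
by exists a, i; rewrite mem_enum mem_iota; split=> //; lia.
Qed.

(** The nonempty proper suffixes of a single image are already distinct. *)
Lemma size_fragments f a : size (f a) <= (size (fragments f)).+1.
Proof.
have -> : size (f a) = ((size (f a)).-1 + (size (f a) != 0)).
  by case: (size _) => //= n; rewrite addn1.
suff : (size (f a)).-1 <= size (fragments f) by case: (_ != _); lia.
rewrite -[X in X <= _](size_iota 1) -(size_map (fun i => drop i (f a))).
apply: uniq_leq_size => [|q /mapP[i]].
  have inj (i j n : nat) : 0 < i < 1 + n.-1 -> 0 < j < 1 + n.-1 ->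
    n - i = n - j -> i = j by lia.
  rewrite map_inj_in_uniq ?iota_uniq // => i j.
  rewrite !mem_iota => li lj /(congr1 size); rewrite !size_drop.
  exact: inj.
by rewrite mem_iota => lt ->; apply/fragmentsP; exists a, i; split=> //; lia.
Qed.

(** The end of [g (take i u)] falls strictly inside the image [h c] of a letter
    of [v], since the two sides of a block do not meet before its end; [z] is
    the part of [h c] after that point. *)
Lemma block_fragment g h u v i : block g h u v -> 0 < i < size u ->
  exists2 z, z \in fragments h & exists w, first_meet g h z (drop i u) w.
Proof.
move=> [_ [gu hv /= e p]] /andP[i0 iu].
(* [v] is cut at the first letter whose image goes beyond [g (take i u)]. *)
pose P j := size (ext g (take i u)) < size (ext h (take j v)).
have lt : size (ext g (take i u)) < size (ext g u).
  rewrite (ext_take_drop g i u) size_cat.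
  by have := size_ext_ge (supported_drop i gu); rewrite size_drop; lia.
have exP : exists j, P j by exists (size v); rewrite /P take_size -e.
case: (ex_minnP exP) => -[|j]; first by rewrite /P take0.
move=> Pj mini.
have jv : j < size v.
  case: leqP => // le; suff /mini : P j by lia.
  by move: Pj; rewrite /P (take_oversize le) (take_oversize (leqW le)).
have : size (ext h (take j v)) <= size (ext g (take i u)).
  by rewrite leqNgt; apply/negP => /mini; lia.
rewrite leq_eqVlt => /orP[/eqP es|lt'].
  suff eq : ext g (take i u) = ext h (take j v) by have := p i j i0 eq; lia.
  have /(congr1 (take (size (ext g (take i u))))) := e.
  rewrite (ext_take_drop g i u) (ext_take_drop h j v) take_size_cat // -es.
  by rewrite take_size_cat.
have [c0 _] : exists c0 : T, True by case: (v) jv => // c0; exists c0.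
move: Pj; rewrite {mini exP}/P => Pj; set c := nth c0 v j.
have dj : drop j v = c :: drop j.+1 v by exact: drop_nth.
have hc : ext h (take j.+1 v) = ext h (take j v) ++ h c.
  by rewrite (take_nth c0) // -cats1 ext_cat /ext /= cats0.
move: Pj; rewrite hc size_cat => Pj.
set d := size (ext g (take i u)) - size (ext h (take j v)).
have e' : ext g (take i u) ++ ext g (drop i u) =
          ext h (take j v) ++ h c ++ ext h (drop j.+1 v).
  by rewrite catA -hc -!ext_take_drop.
have et : ext g (take i u) = ext h (take j v) ++ take d (h c).
  have /(congr1 (take (size (ext g (take i u))))) := e'.
  rewrite take_size_cat // take_cat ltnNge ltnW //= -/d take_cat.
  by case: ltnP => //; rewrite /d; lia.
have ed : ext g (drop i u) = drop d (h c) ++ ext h (drop j.+1 v).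
  have /(congr1 (drop (size (ext g (take i u))))) := e'.
  rewrite drop_size_cat // drop_cat ltnNge ltnW //= -/d drop_cat.
  by case: ltnP => //; rewrite /d; lia.
exists (drop d (h c)).
  by apply/fragmentsP; exists c, d; split=> //; rewrite /d; lia.
exists (drop j.+1 v); split=> //; try exact: supported_drop.
move=> i' j' i'0 em; rewrite size_drop.
suff : size u <= i + i' by lia.
apply: (p _ (j.+1 + j')); first by lia.
by rewrite !takeD !ext_cat hc et em -!catA (catA (take d _)) cat_take_drop.
Qed.

(** By [first_meet_uniq], a fragment of [f] is determined by the fragment of
    [h] given by [block_fragment]. *)
Lemma fragments_blocks g h f : pmarked g -> pmarked h ->
  (forall t, f t != [::] -> exists v, block g h (f t) v) ->
  size (fragments f) <= size (fragments h).
Proof.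
move=> mg mh bl.
apply: (@size_functional _ _ (fun z q => q != [::] /\ z != [::] /\
                                exists w, first_meet g h z q w)).
- exact: undup_uniq.
- move=> q /fragmentsP[t [i [/andP[i0 lt] ->]]].
  have [|v bv] := bl t; first by case: (f t) lt.
  have [|z zf [w fm]] := block_fragment bv (i := i); first by rewrite i0.
  exists z => //; split; first by rewrite -size_eq0 -lt0n size_drop subn_gt0.
  split; last by exists w.
  case/fragmentsP: zf => b [j [lj ->]].
  by rewrite -size_eq0 -lt0n size_drop subn_gt0; case/andP: lj.
move=> z q q' [nq [nz [w fm]]] [_ [_ [w' fm']]].
case: (first_meet_uniq mg mh fm fm') => //.
by case: fm fm' => _ _ -> _ [_ _ -> _]; case: (z) nz.
Qed.

Lemma ohead_ext f x : supported f x ->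
  ohead (ext f x) = obind (fun a => ohead (f a)) (ohead x).
Proof. by case: x => //= a x /andP[]; rewrite /ext /=; case: (f a). Qed.

(** The solution [x] is decomposed into blocks [bs], as a pair [(x, x)], and
    [x'] lists the first letters of the images of these blocks; [g'] and [h']
    are defined only on the letters of [x']. *)
Lemma derived_instance g h x :
  pmarked g -> pmarked h -> prime_solution g h x ->
  exists g' h' x',
    [/\ pmarked g', pmarked h', prime_solution g' h' x', ext g' x' = x &
    size (fragments g') <= size (fragments h) /\
    size (fragments h') <= size (fragments g)].
Proof.
move=> mg mh [nx gx hx e px].
have [bs [e1 e2 bl]] := block_decomposition gx hx e.
(* The default value makes [g'] and [h'] undefined on the other letters. *)
pose pick t := nth ([::], [::]) bs
  (find (fun b => ohead (ext g b.1) == Some t) bs).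
pose g' t := (pick t).1; pose h' t := (pick t).2.
have bne b : b \in bs -> ext g b.1 != [::].
  move=> /bl [nb [gb _ _ _]]; apply: contraNneq nb.
  by move/(ext_eq_nil gb) ->.
have pickP t : (pick t = ([::], [::])) \/
    (pick t \in bs /\ ohead (ext g (pick t).1) = Some t).
  rewrite /pick; set P := (fun b => _).
  case: (boolP (has P bs)) => [hP|/hasNfind ->].
    by right; split; [rewrite mem_nth -?has_find | apply/eqP/(nth_find _ hP)].
  by left; rewrite nth_default.
have pickE t b : b \in bs -> ohead (ext g b.1) = Some t -> pick t = b.
  move=> bbs hb; case: (pickP t) => [|[pbs hp]].
    rewrite /pick; set P := (fun b => _).
    have hP : has P bs by apply/hasP; exists b => //; apply/eqP.
    move=> en; have := nth_find ([::], [::]) hP; rewrite en /P /=.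
    by rewrite /ext.
  have [] := block_uniq mg mh (bl _ pbs) (bl _ bbs).
    by rewrite hp hb.
  by case: (pick t) (b) => [? ?] [? ?] /= -> ->.
have [t0 _] : exists t0 : T, True by case: (x) nx => // t _; exists t.
pose x' := [seq head t0 (ext g b.1) | b <- bs].
have pick_map : [seq pick t | t <- x'] = bs.
  rewrite -map_comp -[RHS]map_id; apply/eq_in_map => b bbs /=.
  by apply: pickE => //; have := bne _ bbs; case: (ext g b.1).
have gx' : ext g' x' = x by rewrite /ext (map_comp fst pick) pick_map -e1.
have hx' : ext h' x' = x by rewrite /ext (map_comp snd pick) pick_map -e2.
have mark (f f' : T -> seq T) :
  (forall t, f' t != [::] ->
     supported f (f' t) /\ ohead (ext f (f' t)) = Some t) ->
  pmarked f'.
  move=> H a b na hab; have nb : f' b != [::].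
    by apply: contraNneq na => nb; move: hab; rewrite nb; case: (f' a).
  have [sa ha] := H _ na; have [sb hb] := H _ nb.
  by apply: Some_inj; rewrite -ha -hb !ohead_ext // hab.
have blg t : g' t != [::] ->
    block g h (g' t) (h' t) /\ ohead (ext g (g' t)) = Some t.
  rewrite /g' /h'; case: (pickP t) => [->|[/bl bt ht]] //.
have blh t : h' t != [::] ->
    block h g (h' t) (g' t) /\ ohead (ext h (h' t)) = Some t.
  rewrite /g' /h'; case: (pickP t) => [->|[/bl bt ht]] // _.
  by split; [apply: block_sym | case: bt ht => _ [_ _ -> _]].
have sg' : supported g' x'.
  rewrite /supported all_map; apply/allP => b bbs /=.
  rewrite /g' (pickE _ b) //; first by have [] := bl _ bbs.
  by have := bne _ bbs; case: (ext g b.1).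
have sh' : supported h' x'.
  rewrite /supported all_map; apply/allP => b bbs /=.
  rewrite /h' (pickE _ b) //; first by have [] := block_sym (bl _ bbs).
  by have := bne _ bbs; case: (ext g b.1).
exists g', h', x'; split=> //.
- by apply: (mark g) => t /blg[[_ []]].
- by apply: (mark h) => t /blh[[_ []]].
- split=> //.
  + by case: (x') gx' nx => // <-.
  + by rewrite gx' hx'.
  (* A prefix of [x'] that is a solution gives a prefix of [x] that is one. *)
  move=> i i0 eq.
  have comp y : supported g' y -> ext g (ext g' y) = ext h (ext h' y).
    elim: y => //= a y IHy /andP[na /IHy {}IHy].
    rewrite /ext /= -!/(ext _ _) !ext_cat IHy; congr (_ ++ _).
    by have [[_ [_ _ ? _]] _] := blg _ na.
  have gi := supported_take i sg'.
  have pre : ext g' (take i x') = take (size (ext g' (take i x'))) x.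
    by rewrite -[in RHS]gx' (ext_take_drop g' i x') take_size_cat.
  have := px (size (ext g' (take i x'))); rewrite -pre => H.
  case: (leqP (size x') i) => // lt.
  have : size x <= size (ext g' (take i x')).
    apply: H; last by rewrite comp // eq.
    by have := size_ext_ge gi; rewrite size_take lt; lia.
  rewrite -[in X in X <= _]gx' (ext_take_drop g' i x') size_cat.
  by have := size_ext_ge (supported_drop i sg'); rewrite size_drop; lia.
- split; first by apply: (fragments_blocks mg mh) => t /blg[]; exists (h' t).
  by apply: (fragments_blocks mh mg) => t /blh[]; exists (g' t).
Qed.

(** * A bound on prime solutions *)

Lemma prime_solution_eq g h g' h' x :
  g =1 g' -> h =1 h' -> prime_solution g h x -> prime_solution g' h' x.
Proof.
move=> eg eh [nx gx hx e px].
have E f f' (ff : f =1 f') y : ext f' y = ext f y by rewrite /ext (eq_map ff).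
have S f f' (ff : f =1 f') : supported f' x = supported f x.
  by apply: eq_all => a; rewrite ff.
split; rewrite // ?(E _ _ eg) ?(E _ _ eh) ?(S _ _ eg) ?(S _ _ eh) //.
by move=> i i0; rewrite (E _ _ eg) (E _ _ eh); apply: px.
Qed.

Section Bound.
Variable s : nat.

(** An instance whose images have length at most [s.+1], given by the partial
    table of its letters, together with the first letter of a solution. *)
Definition state : finType :=
  ({ffun T * bool * 'I_s.+1 -> option T} * option T)%type.

Definition state_of g h x : state :=
  ([ffun k : T * bool * 'I_s.+1 =>
     onth ((if k.1.2 then g else h) k.1.1) k.2], ohead x).

Lemma state_of_inj g h x g' h' x' :
  (forall a, [/\ size (g a) <= s.+1, size (h a) <= s.+1,
                 size (g' a) <= s.+1 & size (h' a) <= s.+1]) ->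
  state_of g h x = state_of g' h' x' ->
  [/\ g =1 g', h =1 h' & ohead x = ohead x'].
Proof.
move=> sz [/ffunP e ->].
have E b a : (if b then g else h) a = (if b then g' else h') a.
  apply: eq_from_onth => i; case: (ltnP i s.+1) => [lt|le].
    by have := e (a, b, Ordinal lt); rewrite !ffunE.
  by rewrite !onth_default //; case: b; case: (sz a) => *; apply: leq_trans le.
by split=> // a; [apply: (E true) | apply: (E false)].
Qed.

Definition bounded g h :=
  size (fragments g) <= s /\ size (fragments h) <= s.

Lemma bounded_size g h a : bounded g h ->
  size (g a) <= s.+1 /\ size (h a) <= s.+1.
Proof.
by move=> [bg bh]; split; apply: leq_trans (size_fragments _ _) _; rewrite ltnS.
Qed.

Lemma size_ext_le f x m :
  (forall a, size (f a) <= m) -> size (ext f x) <= m * size x.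
Proof.
move=> le; elim: x => [|a x IHx]; first by rewrite muln0.
by rewrite -cat1s ext_cat size_cat {1}/ext /= cats0 mulnS leq_add.
Qed.

(** The letters of [x] have images of length one, so [g] and [h] agree on the
    first letter of [x], which is therefore a solution. *)
Lemma prime_stationary g h x :
  prime_solution g h x -> size (ext g x) <= size x -> size x = 1.
Proof.
case: x => [|a x] [// _ gx hx e px] le.
have one f : supported f (a :: x) -> size (ext f (a :: x)) <= size (a :: x) ->
    f a = take 1 (ext f (a :: x)).
  move=> /= /andP[fa /size_ext_ge]; rewrite /ext /= -/(ext f x) size_cat.
  by case: (f a) fa => //= b [|b' w] //= _; rewrite ?take0 //; lia.
have := px 1 isT; rewrite /= take0 /ext /= !cats0 => H.
by apply/eqP; rewrite eqn_leq H // (one g) // (one h) -?e.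
Qed.

(** Here [V] lists the states met before [(g, h, x)] in a sequence of derived
    instances. The solution preceding [x] in the sequence is [ext g x], and the
    last hypothesis says that the solutions at the states of [V] were at least
    as long as it. If [(g, h, x)] is in one of these states then [x] is equal to
    an earlier solution, hence at least as long as [ext g x], and
    [prime_stationary] applies. *)
Lemma prime_size_visited n (V : seq state) g h x :
  pmarked g -> pmarked h -> prime_solution g h x -> bounded g h ->
  uniq V -> size V + n = #|{: state}| ->
  (forall q, q \in V -> exists g1 h1 x1,
    [/\ prime_solution g1 h1 x1, bounded g1 h1, q = state_of g1 h1 x1 &
        size (ext g x) <= size x1]) ->
  size x <= s.+1 ^ n.
Proof.
elim: n V g h x => [|n IHn] V g h x mg mh p b uV sV vis.
all: have [/vis[g1 [h1 [x1 [p1 b1 e1 le1]]]]|nV] :=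
  boolP (state_of g h x \in V).
1,3: suff x1E : size x = 1 by rewrite x1E expn_gt0.
1,2: apply: (prime_stationary p); suff xE : x = x1 by rewrite {2}xE.
1,2: have [a|e2 e3 hd] := state_of_inj _ e1;
  first by have [? ?] := bounded_size a b; have [? ?] := bounded_size a b1.
1,2: apply: (prime_solution_uniq mg mh) => //.
1,2: by apply: prime_solution_eq p1 => a; rewrite ?e2 ?e3.
- (* All states are in [V]. *)
  have := uniq_leq_size (s1 := state_of g h x :: V) (s2 := enum {: state}).
  rewrite /= nV uV -cardE => /(_ isT); rewrite -sV addn0 ltnn => H.
  by suff: false by []; apply: H => q _; rewrite mem_enum.
have [g' [h' [x' [mg' mh' p' ex [bg bh]]]]] := derived_instance mg mh p.
have b' : bounded g' h'.
  by case: b => ? ?; split; [apply: leq_trans bg _ | apply: leq_trans bh _].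
have := IHn (state_of g h x :: V) g' h' x' mg' mh' p' b'.
rewrite /= nV uV addSnnS sV => /(_ isT erefl) IH.
rewrite -ex expnS; apply: leq_trans (size_ext_le (m := s.+1) _ _) _.
  by move=> a; have [] := bounded_size a b'.
rewrite leq_mul2l /=; apply: IH => q; rewrite inE => /orP[/eqP ->|/vis].
  by exists g, h, x; split; rewrite // ex.
move=> [g1 [h1 [x1 [p1 b1 e1 le1]]]]; exists g1, h1, x1; split=> //.
by rewrite ex; apply: leq_trans le1; apply: size_ext_ge; case: p.
Qed.

Lemma prime_solution_size g h x :
  pmarked g -> pmarked h -> prime_solution g h x -> bounded g h ->
  size x <= length_bound #|T| s.
Proof.
move=> mg mh p b; have := @prime_size_visited _ [::] g h x mg mh p b isT erefl.
rewrite /length_bound.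
by rewrite card_prod card_ffun !card_prod card_option card_bool card_ord; apply.
Qed.
End Bound.
End PartialMarked.

(** * Left unitary submonoids are free *)

Section Free.
Variable Sigma : finType.
Implicit Types (M : {pred seq Sigma}) (x y : seq Sigma).

Definition irreducible M x :=
  [/\ x != [::], x \in M & forall i, 0 < i -> take i x \in M -> size x <= i].

Definition left_unitary M :=
  [::] \in M /\ (forall x y, x \in M -> (x ++ y \in M) = (y \in M)).

(** Existence of a factorisation: split off the shortest nonempty prefix in
    [M], which is irreducible, and the rest is again in [M]. Uniqueness: no
    irreducible word is a proper prefix of another one. *)
Lemma irreducible_basis M B : left_unitary M -> uniq B ->
  (forall x, reflect (irreducible M x) (x \in B)) -> is_basis M B.
Proof.
move=> [M0 MU] uB BP; split=> //.
- elim=> //= b s IHs sB; have /BP[_ bM _] := sB b (mem_head _ _).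
  by rewrite MU // IHs // => w ws; apply: sB; rewrite inE ws orbT.
- move=> x; have [n] := ubnP (size x).
  elim: n x => // n IHn x /ltnSE le xM; case: (eqVneq x [::]) => [->|nx].
    by exists [::].
  have exi : exists i, (0 < i) && (take i x \in M).
    by exists (size x); rewrite lt0n size_eq0 nx take_size.
  case: (ex_minnP exi) => i /andP[i0 iM] mini.
  have ix : i <= size x by apply: mini; rewrite lt0n size_eq0 nx take_size.
  have tB : take i x \in B.
    apply/BP; split=> //; first by rewrite -size_eq0 size_takel // -lt0n.
    move=> j j0; rewrite size_takel //; case/orP: (leq_total i j) => // ji.
    by rewrite -take_min (minn_idPl ji) => jM; apply: mini; rewrite j0.
  have [||s sB e] := IHn (drop i x).
  + by rewrite size_drop; have := leq_trans i0 ix; lia.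
  + by rewrite -(MU _ _ iM) cat_take_drop.
  exists (take i x :: s) => [w|/=]; last by rewrite -e cat_take_drop.
  by rewrite inE => /orP[/eqP -> //|]; apply: sB.
have half b b' w w' : b \in B -> b' \in B -> b ++ w = b' ++ w' ->
    size b <= size b' -> b = b'.
  move=> /BP[nb bM _] /BP[_ _ pb'] e le.
  have eb : b = take (size b) b'.
    by rewrite -(takel_cat w' le) -e take_size_cat.
  have := pb' (size b); rewrite -eb lt0n size_eq0 => /(_ nb bM) ge.
  by rewrite eb take_oversize.
elim=> [|b s IHs] [|b' t] //= sB tB.
- have /BP[nb _ _] := tB b' (mem_head _ _); by case: (b') nb.
- have /BP[nb _ _] := sB b (mem_head _ _); by case: (b) nb.
have bB := sB b (mem_head _ _); have b'B := tB b' (mem_head _ _) => e.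
have bb : b = b'.
  case: (leqP (size b) (size b')) => [|/ltnW]; first exact: half e.
  by move/(half _ _ _ _ b'B bB (esym e)).
rewrite bb in e *; congr (_ :: _); apply: IHs.
- by move=> w ws; apply: sB; rewrite inE ws orbT.
- by move=> w ws; apply: tB; rewrite inE ws orbT.
by move/(congr1 (drop (size b'))): e; rewrite !drop_size_cat.
Qed.
End Free.

(** * The two algorithms *)

(** In this part [c] is the code of an instance: a list formed of the sizes of
    the two alphabets and of the codes of the two morphisms. The letters are
    identified with their ranks and a word with the list of its letters. *)
Definition alphabet_size c := nth 0 (decode c) 0.
Definition substitute (ws x : seq nat) : seq nat :=
  foldr (fun a r => decode (nth 0 ws a) ++ r) [::] x.
Definition agree c x :=
  substitute (decode (nth 0 (decode c) 2)) x ==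
  substitute (decode (nth 0 (decode c) 3)) x.

Definition prime_word c (x : seq nat) :=
  [&& x != [::], all (fun a => a < alphabet_size c) x, agree c x
    & all (fun i => (i == 0) || ~~ agree c (take i x)) (iota 0 (size x))].

(** Numbers coded by a list are less than its code. So both alphabets have
    less than [c] letters, their disjoint union less than [c + c], all images
    of letters are shorter than [c], and there are at most [(c + c) * c]
    nonempty proper suffixes of such images. Each letter of a word contributes
    at most [c] to the exponent in [code_lt]. *)
Definition code_bound c := 2 ^ (c * length_bound (c + c) ((c + c) * c)).

Definition basis_code c :=
  code [seq n <- iota 0 (code_bound c) | prime_word c (decode n)].

(** A state [q < code_bound c] is the code of the word read since the last
    visit to the equaliser, in particular [0] is the code of the empty word,
    and [code_bound c] is the sink. *)
Definition next_state c q a :=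
  if code_bound c <= q then code_bound c
  else if agree c (rcons (decode q) a) then 0
  else if code_bound c <= code (rcons (decode q) a) then code_bound c
  else code (rcons (decode q) a).

Definition automaton_code c :=
  code [:: (code_bound c).+1; 0; code [:: 0];
    code [seq code [seq next_state c q a | a <- iota 0 (alphabet_size c)]
         | q <- iota 0 (code_bound c).+1]].

Lemma computable_agree k C X :
  computable k C -> computable k (fun s => code (X s)) ->
  computable k (fun s => agree (C s) (X s)).
Proof.
apply: (@computable_list2 (fun c l => agree c l)).
rewrite /agree /substitute; computable.
Qed.
#[local] Hint Resolve computable_agree : computable.

Lemma computable_code_bound k C : computable k C ->
  computable k (fun s => code_bound (C s)).
Proof.
apply: (@computable_op1 code_bound); rewrite /code_bound /length_bound.
computable.
Qed.
#[local] Hint Resolve computable_code_bound : computable.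

Lemma computable_next_state k C F G :
  computable k C -> computable k F -> computable k G ->
  computable k (fun s => next_state (C s) (F s) (G s)).
Proof.
by apply: (@computable_op3 next_state); rewrite /next_state; computable.
Qed.
#[local] Hint Resolve computable_next_state : computable.

Lemma computable_basis_code : computable 1 (fun s => basis_code (head 0 s)).
Proof. by rewrite /basis_code /prime_word /alphabet_size /=; computable. Qed.

Lemma computable_automaton_code :
  computable 1 (fun s => automaton_code (head 0 s)).
Proof. rewrite /automaton_code /alphabet_size; computable. Qed.

(** * Words as lists of ranks *)

Section Ranks.
Variable T : finType.
Definition ranks (x : seq T) : seq nat := [seq val (enum_rank a) | a <- x].

Lemma ranks_cat x y : ranks (x ++ y) = ranks x ++ ranks y.
Proof. exact: map_cat. Qed.

Lemma ranks_inj : injective ranks.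
Proof. by apply: inj_map => a b /val_inj/enum_rank_inj. Qed.

Lemma ranks_surj l : all (fun a => a < #|T|) l -> exists x, ranks x = l.
Proof.
elim: l => [|a l IHl] /=; first by exists [::].
move=> /andP[lt /IHl[x <-]]; exists (enum_val (Ordinal lt) :: x).
by rewrite /= enum_valK.
Qed.

Lemma all_ranks x : all (fun a => a < #|T|) (ranks x).
Proof. by apply/allP => _ /mapP[a _ ->]; apply: ltn_ord. Qed.

Lemma ranks_enum : ranks (enum T) = iota 0 #|T|.
Proof.
apply: (@eq_from_nth _ 0); rewrite size_map -?cardE ?size_iota // => i lt.
have [a _] : exists a : T, a \in T by apply/card_gt0P; apply: leq_ltn_trans lt.
rewrite (nth_map a) -?cardE // nth_iota //.
rewrite -[nth _ _ i]/(nth a (enum T) (Ordinal lt)).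
by rewrite -enum_val_nth enum_valK.
Qed.

Lemma code_word_inj : injective (@code_word T).
Proof. by move=> x y /(can_inj CodeSeq.codeK)/ranks_inj. Qed.
End Ranks.

Lemma code_lt m l : all (fun a => a < m) l -> code l < 2 ^ (m * size l).
Proof.
elim: l => [|a l IHl]; first by rewrite muln0.
rewrite [all _ _]/= => /andP[lt /IHl le].
rewrite codeE [size _]/= (mulnS m) expnD.
apply: (@leq_trans (2 ^ a.+1 * 2 ^ (m * size l))); last first.
  by rewrite leq_mul // leq_pexp2l.
rewrite expnS -mulnA [2 * _]mulnC -mulnA ltn_pmul2l ?expn_gt0 //; lia.
Qed.

Lemma code_take l i : code (take i l) <= code l.
Proof.
elim: l i => [|a l IHl] [|i] //; rewrite -/(take i.+1 (a :: l)) /= -/(code _).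
by rewrite leq_mul // ltnS leq_double; apply: IHl.
Qed.

(** * Correctness of the algorithms *)

Section Instance.
Variables Sigma Delta : finType.

Lemma word_morphismE (f : seq Sigma -> seq Delta) x :
  word_morphism f -> f x = flatten [seq f [:: a] | a <- x].
Proof. by move=> [f0 fM]; elim: x => //= a x <-; rewrite -cat1s fM. Qed.

Lemma substitute_code (f : seq Sigma -> seq Delta) x : word_morphism f ->
  substitute (decode (code_morphism f)) (ranks x) = ranks (f x).
Proof.
move=> mf; rewrite (word_morphismE x mf) CodeSeq.codeK; elim: x => //= a x ->.
rewrite ranks_cat; congr (_ ++ _); rewrite (nth_map [::]); last first.
  by rewrite size_map -cardE.
by rewrite (nth_map a) -?cardE // nth_enum_rank /code_word CodeSeq.codeK.
Qed.

Lemma size_le_code_word (T : finType) (w : seq T) : size w <= code_word w.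
Proof. by apply: leq_trans (size_le_code _); rewrite size_map. Qed.

Lemma size_code_morphism (f : seq Sigma -> seq Delta) a :
  size (f [:: a]) <= code_morphism f.
Proof.
have /allP lt := CodeSeq.ltn_code
  [seq code_word w | w <- [seq f [:: b] | b <- enum Sigma]].
apply: leq_trans (size_le_code_word _) (ltnW _); apply: lt.
by apply/map_f/(map_f (fun b => f [:: b])); rewrite mem_enum.
Qed.

(** This makes an instance over a single alphabet, the disjoint union, out of an
    instance over two; the letters of [Delta] are outside the domain. *)
Definition sum_morphism (f : seq Sigma -> seq Delta) (t : Sigma + Delta) :
    seq (Sigma + Delta) :=
  if t is inl a then [seq inr b | b <- f [:: a]] else [::].

Lemma ext_sum_morphism f x : word_morphism f ->
  ext (sum_morphism f) [seq inl a | a <- x] = [seq inr b | b <- f x].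
Proof.
move=> mf; rewrite (word_morphismE x mf) map_flatten /ext -!map_comp.
by congr flatten; apply: eq_map.
Qed.

Lemma supported_sum_morphism f x : marked f ->
  supported (sum_morphism f) [seq inl a | a <- x].
Proof.
move=> [ne _]; rewrite /supported all_map; apply/allP => a _ /=.
by case: (f _) (ne a).
Qed.

Lemma pmarked_sum_morphism f : marked f -> pmarked (sum_morphism f).
Proof.
move=> [ne dist] [a|//] [b|] /=; last by case: (f _).
have [-> //|nab _ e] := eqVneq a b; case: (dist a b); first exact/eqP.
by case: (f [:: a]) (f [:: b]) e => [|a' u] [|b' v] //= [->].
Qed.

Lemma size_fragments_sum_morphism f c : (forall a, size (f [:: a]) <= c) ->
  size (fragments (sum_morphism f)) <= (#|Sigma| + #|Delta|) * c.
Proof.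
move=> le; apply: leq_trans (size_undup _) _; rewrite size_allpairs_dep.
rewrite -card_sum cardE; elim: (enum _) => //= t ts IHts.
rewrite mulSn leq_add // size_iota; case: t => //= a.
by rewrite size_map; have := le a; lia.
Qed.


Variables g h : seq Sigma -> seq Delta.
Hypotheses (gM : word_morphism g) (hM : word_morphism h).
Let c := code_instance g h.

Lemma instance_components :
  decode c = [:: #|Sigma|; #|Delta|; code_morphism g; code_morphism h].
Proof. exact: CodeSeq.codeK. Qed.

Lemma instance_lt : [/\ #|Sigma| < c, #|Delta| < c, code_morphism g < c
  & code_morphism h < c].
Proof.
have := CodeSeq.gtn_decode c; rewrite instance_components /=.
by case/and5P.
Qed.

Lemma alphabet_sizeE : alphabet_size c = #|Sigma|.
Proof. by rewrite /alphabet_size instance_components. Qed.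

Lemma agreeE x : agree c (ranks x) = (x \in equaliser g h).
Proof.
rewrite /agree instance_components !substitute_code // inE.
exact: (inj_eq (@ranks_inj _)).
Qed.

Lemma prime_wordP x :
  reflect (irreducible (equaliser g h) x) (prime_word c (ranks x)).
Proof.
rewrite /prime_word alphabet_sizeE all_ranks agreeE size_map.
apply: (iffP and4P) => [[nx _ xM /allP px]|[nx xM px]]; split=> //.
- by case: (x) nx.
- move=> i i0 iM; rewrite leqNgt; apply/negP => lt.
  by have := px i; rewrite mem_iota lt -map_take agreeE iM => /(_ isT); lia.
- by case: (x) nx.
apply/allP => i; rewrite mem_iota add0n -map_take agreeE => /andP[_ lt].
case: (posnP i) => //= i0; apply/negP => /(px i i0); lia.
Qed.

Lemma equaliser_unitary : left_unitary (equaliser g h).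
Proof.
have [[g0 gD] [h0 hD]] := (gM, hM).
split=> [|x y]; rewrite !inE ?g0 ?h0 // gD hD => /eqP ->.
by rewrite eqseq_cat // eqxx.
Qed.

Hypotheses (gm : marked g) (hm : marked h).

Lemma irreducible_prime x : irreducible (equaliser g h) x ->
  prime_solution (sum_morphism g) (sum_morphism h) [seq inl a | a <- x].
Proof.
have inj := inj_map (@inr_inj Sigma Delta).
move=> [nx /eqP ex px]; split.
- by case: (x) nx.
- exact: supported_sum_morphism.
- exact: supported_sum_morphism.
- by rewrite !ext_sum_morphism // ex.
move=> i i0; rewrite -map_take !ext_sum_morphism // size_map => /inj e.
by apply: px => //; apply/eqP.
Qed.

Lemma irreducible_code_bound x : irreducible (equaliser g h) x ->
  code (ranks x) < code_bound c.
Proof.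
move=> ix; have [ltS ltD ltg lth] := instance_lt.
apply: leq_trans (code_lt (all_ranks x)) _; rewrite leq_pexp2l // size_map.
rewrite leq_mul ?(ltnW ltS) //.
have b : bounded ((c + c) * c) (sum_morphism g) (sum_morphism h).
  have le f : code_morphism f < c ->
      size (fragments (sum_morphism f)) <= (c + c) * c.
    move=> lt; apply: (@leq_trans ((#|Sigma| + #|Delta|) * c)); last first.
      by rewrite leq_mul // leq_add // ltnW.
    apply: size_fragments_sum_morphism => a.
    exact: leq_trans (size_code_morphism f a) (ltnW lt).
  by split; apply: le.
have := prime_solution_size (pmarked_sum_morphism gm) (pmarked_sum_morphism hm)
  (irreducible_prime ix) b.
rewrite size_map => /leq_trans; apply; rewrite -/(length_bound #|_| _).
by apply: length_bound_mono => //; rewrite card_sum leq_add // ltnW.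
Qed.

Lemma words_of_codes ns :
  all (fun n => all (fun a => a < #|Sigma|) (decode n)) ns ->
  exists B : seq (seq Sigma), [seq code_word w | w <- B] = ns.
Proof.
elim: ns => [|n ns IHns] /=; first by exists [::].
move=> /andP[/ranks_surj[w e] /IHns[B <-]]; exists (w :: B) => /=.
by rewrite /code_word -/(ranks w) e CodeSeq.decodeK.
Qed.

Lemma basis_code_correct : exists B : seq (seq Sigma),
  basis_code c = code_words B /\ is_basis (equaliser g h) B.
Proof.
have [|B eB] := @words_of_codes
    [seq n <- iota 0 (code_bound c) | prime_word c (decode n)].
  apply/allP => n; rewrite mem_filter => /andP[/and4P[_ lt _ _] _].
  by rewrite -alphabet_sizeE.
exists B; split; first by rewrite /basis_code /code_words eB.
apply: irreducible_basis.
- exact: equaliser_unitary.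
- apply: (map_uniq (f := @code_word Sigma)).
  by rewrite eB filter_uniq ?iota_uniq.
move=> x; rewrite -(mem_map (@code_word_inj _)) eB mem_filter mem_iota add0n.
rewrite {1}/code_word CodeSeq.codeK -/(ranks x) /=.
apply: (iffP andP) => [[/prime_wordP]|ix] //.
by split; [apply/prime_wordP | apply: irreducible_code_bound].
Qed.

Lemma code_bound_gt0 : 0 < code_bound c.
Proof. by rewrite expn_gt0. Qed.

Lemma next_state_le q a : next_state c q a <= code_bound c.
Proof.
rewrite /next_state; case: ifP => // _; case: ifP => // _.
by case: ifPn => //; rewrite -ltnNge => /ltnW.
Qed.

Definition equaliser_automaton : automaton Sigma :=
  @Automaton Sigma (code_bound c).+1 ord0 [set ord0]
    (fun q a => inord (next_state c q (enum_rank a))).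

Lemma code_equaliser_automaton :
  automaton_code c = code_automaton equaliser_automaton.
Proof.
rewrite /automaton_code /code_automaton.
rewrite [nstates _]/= [start _]/= [accepting _]/=.
rewrite enum_set1 -(val_enum_ord (code_bound c).+1) -map_comp.
congr (code [:: _; _; _; code _]); apply: eq_map => q /=; congr code.
rewrite alphabet_sizeE -ranks_enum /ranks -map_comp; apply: eq_map => a /=.
by rewrite inordK // ltnS next_state_le.
Qed.

(** In [x = e ++ p] the word [e] is the longest prefix in the equaliser. The
    state is [code p], or the sink once [p] has a prefix of too large a
    code. *)
Lemma automaton_run x : exists e p,
  [/\ x = e ++ p, e \in equaliser g h,
      forall i, 0 < i <= size p -> take i p \notin equaliser g h &
      let q := val (foldl (@transition _ equaliser_automaton) ord0 x) in
      q = code (ranks p) /\ q < code_bound c \/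
      q = code_bound c /\ exists i, code_bound c <= code (ranks (take i p))].
Proof.
have [M0 MU] := equaliser_unitary.
elim/last_ind: x => [|x a [e [p [ex eM pM]]]] /=.
  exists [::], [::]; split=> // [[]//|]; left; split=> //.
  exact: code_bound_gt0.
rewrite foldl_rcons; set q := foldl _ _ x => qP.
have step : val (@transition _ equaliser_automaton q a) =
    next_state c (val q) (enum_rank a).
  by rewrite /= inordK // ltnS next_state_le.
rewrite step.
have tk i : i <= size p -> take i (rcons p a) = take i p.
  by move=> le; rewrite -cats1 takel_cat.
have notM : rcons p a \notin equaliser g h ->
    forall i, 0 < i <= size (rcons p a) ->
      take i (rcons p a) \notin equaliser g h.
  move=> nM i; rewrite size_rcons => /andP[i0]; rewrite leq_eqVlt ltnS.
  case/orP => [/eqP ->|le]; first by rewrite take_oversize ?size_rcons.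
  by rewrite tk // pM ?i0.
case: qP => [[eq lt]|[eq [i ge]]].
  rewrite /next_state leqNgt lt /= eq CodeSeq.codeK.
  have -> : rcons (ranks p) (enum_rank a) = ranks (rcons p a).
    by rewrite /ranks map_rcons.
  rewrite agreeE; case: ifPn => [rM|nM].
    exists (rcons x a), [::]; rewrite cats0 ex; split=> //.
    - by rewrite rcons_cat MU.
    - by case.
    by left; rewrite code_bound_gt0.
  exists e, (rcons p a); split=> //; first by rewrite ex rcons_cat.
    exact: notM.
  case: ifPn => [ge|]; last by rewrite -ltnNge => lt'; left.
  by right; split=> //; exists (size p).+1; rewrite take_oversize ?size_rcons.
rewrite /next_state /= eq leqnn; exists e, (rcons p a); split=> //.
- by rewrite ex rcons_cat.
- apply: notM; apply/negP => rM.
  (* Otherwise [rcons p a] would be an irreducible word of too large a code. *)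
  have /irreducible_code_bound : irreducible (equaliser g h) (rcons p a).
    split=> //; first by rewrite -size_eq0 size_rcons.
    move=> j j0; rewrite size_rcons; case: (leqP j (size p)) => [le|] //.
    by rewrite tk // (negbTE (pM j _)) // j0.
  rewrite ltnNge => /negP; apply; apply: leq_trans ge _.
  have -> : take i p = take (minn i (size p)) (rcons p a).
    by rewrite tk ?geq_minr // take_min take_size.
  by rewrite /ranks map_take code_take.
right; split=> //; exists (minn i (size p)).
by rewrite tk ?geq_minr // take_min take_size.
Qed.

Lemma equaliser_automaton_correct :
  recognises equaliser_automaton (equaliser g h).
Proof.
have [M0 MU] := equaliser_unitary.
move=> x; have [e [p [ex eM pM]]] := automaton_run x.
rewrite /accepts [start _]/= [accepting _]/= in_set1 -val_eqE /=.
set q := foldl _ _ x => qP; rewrite {1}ex MU //.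
have np : p != [::] -> p \notin equaliser g h.
  by move=> n; rewrite -[p]take_size pM // leqnn lt0n size_eq0 n.
case: (eqVneq p [::]) qP => [-> /=|n] qP.
  rewrite M0; case: qP => [[-> _] //|[_ [i]]].
  by rewrite leqNgt; case: i => [|i] /=; rewrite code_bound_gt0.
rewrite (negbTE (np n)); case: qP => [[-> _]|[-> _]].
  by case: (p) n => //= a w _; rewrite muln_eq0 expn_eq0.
by rewrite eqn0Ngt code_bound_gt0.
Qed.
End Instance.

Theorem corollary8 :
  (exists alg : recfun 1,
     forall (Sigma Delta : finType) (g h : seq Sigma -> seq Delta),
       word_morphism g -> word_morphism h -> marked g -> marked h ->
       exists B : seq (seq Sigma),
         alg \on [tuple code_instance g h] ~> code_words B /\
         is_basis (equaliser g h) B) /\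
  (exists alg : recfun 1,
     forall (Sigma Delta : finType) (g h : seq Sigma -> seq Delta),
       word_morphism g -> word_morphism h -> marked g -> marked h ->
       exists A : automaton Sigma,
         alg \on [tuple code_instance g h] ~> code_automaton A /\
         recognises A (equaliser g h)).
Proof.
have [[basis basisP] [aut autP]] :=
  (computable_basis_code, computable_automaton_code).
split; [exists basis | exists aut] => Sigma Delta g h gM hM gm hm.
  have [B [eB BP]] := basis_code_correct gM hM gm hm.
  by exists B; split=> //; rewrite -eB; apply: basisP.
exists (equaliser_automaton g h); split.
  by rewrite -code_equaliser_automaton; apply: autP.
exact: equaliser_automaton_correct.
Qed.
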